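(* Let $\mathbb I=[0,1]$ and let $\mathcal M$ be the ideal of meager subsets of the Hilbert cube $\mathbb I^\omega$. Then: (1) $\mathcal M$ is a maximal non-trivial topologically invariant ideal with BP-base on $\mathbb I^\omega$ (i.e. $\mathcal M$ is such an ideal, and every non-trivial topologically invariant ideal $\mathcal I$ with BP-base on $\mathbb I^\omega$ with $\mathcal M\subseteq\mathcal I$ satisfies $\mathcal I=\mathcal M$); (2) $\mathcal M$ is the largest non-trivial topologically invariant ideal with $\sigma$-compact base on $\mathbb I^\omega$ (i.e. $\mathcal M$ is such an ideal, and every non-trivial topologically invariant ideal $\mathcal I$ with $\sigma$-compact base on $\mathbb I^\omega$ satisfies $\mathcal I\subseteq\mathcal M$).
   Context: An ideal on a set $X$ is a non-empty family of subsets of $X$ closed under taking subsets and finite unions. An ideal $\mathcal I$ on $X$ is non-trivial if it contains some uncountable subset of $X$ and $\mathcal I\ne\mathcal P(X)$. An ideal $\mathcal I$ on a topological space $X$ is topologically invariant if $\mathcal I=\{h(A):A\in\mathcal I\}$ for every homeomorphism $h:X\to X$. A subfamily $\mathcal B\subseteq\mathcal I$ is a base for $\mathcal I$ if each $A\in\mathcal I$ is contained in some $B\in\mathcal B$. A subset $A\subseteq X$ has the Baire property (is a BP-set) if $A\triangle U$ is meager for some open $U\subseteq X$. An ideal has BP-base (resp. $\sigma$-compact base) if it has a base consisting of BP-sets (resp. $\sigma$-compact sets). *)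

(* Defs.v *)
From mathcomp Require Import all_boot all_order all_algebra.
From mathcomp Require Import all_classical all_reals all_analysis.
Import numFieldNormedType.Exports.

Set Implicit Arguments.
Unset Strict Implicit.
Unset Printing Implicit Defensive.

Local Open Scope classical_set_scope.

Section SetIdeals.
Context {X : Type}.
Implicit Types (I : set (set X)) (A B : set X).

Definition ideal I : Prop :=
  [/\ I !=set0,
      forall A B, A `<=` B -> I B -> I A &
      forall A B, I A -> I B -> I (A `|` B)].

Definition nontrivial I : Prop :=
  (exists2 A, I A & ~ countable A) /\ I <> [set: set X].

Definition ideal_base I (B : set (set X)) : Prop :=
  B `<=` I /\ forall A, I A -> exists2 C, B C & A `<=` C.

Definition has_base_of (P : set (set X)) I : Prop :=
  exists2 B : set (set X), ideal_base I B & B `<=` P.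

End SetIdeals.

Section TopologicalIdeals.
Context {X : topologicalType}.
Implicit Types (A : set X) (h : X -> X).

Definition homeomorphism h : Prop :=
  continuous h /\
  exists g : X -> X, [/\ continuous g, cancel h g & cancel g h].

Definition topologically_invariant (I : set (set X)) : Prop :=
  forall h, homeomorphism h -> I = [set h @` A | A in I].

Definition nowhere_dense A : Prop := (closure A)° = set0.

Definition meager A : Prop :=
  exists2 F : nat -> set X,
    forall n, nowhere_dense (F n) & A = \bigcup_n F n.

Definition baire_property A : Prop :=
  exists2 U : set X, open U & meager (A `+` U).

Definition sigma_compact A : Prop :=
  exists2 K : nat -> set X, forall n, compact (K n) & A = \bigcup_n K n.

Definition nontrivial_invariant_ideal (I : set (set X)) : Prop :=
  [/\ ideal I, nontrivial I & topologically_invariant I].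

Definition has_BP_base (I : set (set X)) : Prop :=
  has_base_of baire_property I.

Definition has_sigma_compact_base (I : set (set X)) : Prop :=
  has_base_of sigma_compact I.

End TopologicalIdeals.

(* An abbreviation, so that the product topology on [prod_topology] and the
   subspace topology on [set_type] are found by instance inference. *)
Notation hilbert_cube R :=
  (prod_topology (fun _ : nat => set_type (`[0%R, 1%R]%classic : set R))).

(* Main.v *)
(* A nonempty open set U cannot belong to a proper topologically invariant ideal
   on the Hilbert cube: the homeomorphism group acts minimally, so every point has
   a neighbourhood that is a homeomorphic copy of U, and by compactness finitely
   many copies cover the cube. A set of a BP-base (together with the meager sets)
   or of a sigma-compact base that is not meager would put such a U in the ideal.

   Minimality is not achieved by coordinatewise maps, which preserve the set of
   endpoints: coordinates are pushed off 0 and 1 one at a time, by rotating the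
   square spanned by the coordinates n and n + 1. *)
Require Import Defs.
From mathcomp Require Import all_boot all_order all_algebra.
From mathcomp Require Import all_classical all_reals all_analysis.
From mathcomp Require Import ring lra.
Import numFieldNormedType.Exports.
Import Order.TTheory GRing.Theory Num.Theory.

Set Implicit Arguments.
Unset Strict Implicit.
Unset Printing Implicit Defensive.

Local Open Scope classical_set_scope.
Local Open Scope ring_scope.

(** * Meager sets under homeomorphisms, and Baire category *)

Section Topology.
Context {X : topologicalType}.
Implicit Types (A B U : set X) (h : X -> X).

Lemma homeomorphism_id : homeomorphism (@id X).
Proof.
have cid : continuous (@id X) by move=> x; exact: cvg_id.
by split=> //; exists id.
Qed.

Lemma homeomorphism_comp h k :
  homeomorphism h -> homeomorphism k -> homeomorphism (h \o k).
Proof.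
move=> [ch [h' [ch' hK h'K]]] [ck [k' [ck' kK k'K]]]; split.
  by move=> x; apply: continuous_comp; [exact: ck|exact: ch].
exists (k' \o h'); split; [|exact: can_comp..].
by move=> x; apply: continuous_comp; [exact: ch'|exact: ck'].
Qed.

Lemma homeomorphism_image_closure h A :
  homeomorphism h -> closure (h @` A) `<=` h @` closure A.
Proof.
move=> [ch [g [cg hK gK]]] y hAy; exists (g y); last exact: gK.
move=> B /cg /hAy [_ [[a Aa <-]] /=]; rewrite hK => Ba.
by exists a.
Qed.

Lemma nowhere_denseS A B : A `<=` B -> nowhere_dense B -> nowhere_dense A.
Proof.
rewrite /nowhere_dense => AB B0; rewrite -subset0 -B0.
exact/interiorS/closureS.
Qed.

Lemma nowhere_dense_homeomorphism h A :
  homeomorphism h -> nowhere_dense A -> nowhere_dense (h @` A).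
Proof.
move=> hh A0; have [ch [g [cg hK gK]]] := hh.
rewrite /nowhere_dense -subset0 => y hAy.
suff : (closure A)° (g y) by rewrite A0.
have : nbhs (g y) (h @^-1` closure (h @` A)).
  by apply: ch; rewrite gK; exact: hAy.
apply: filterS => x /=.
move=> /(homeomorphism_image_closure hh)[z Az /(can_inj hK) <-].
exact: Az.
Qed.

Lemma nowhere_dense_meager A : nowhere_dense A -> meager A.
Proof.
by move=> A0; exists (fun=> A) => //; rewrite bigcup_const//; exists 0%N.
Qed.

Lemma meager0 : meager (@set0 X).
Proof.
by apply: nowhere_dense_meager; rewrite /nowhere_dense closure0 interior0.
Qed.

Lemma meagerS A B : A `<=` B -> meager B -> meager A.
Proof.
move=> AB [F F0 BE]; exists (fun n => A `&` F n).
  by move=> n; apply: nowhere_denseS (F0 n); exact: subIsetr.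
by rewrite -setI_bigcupr -BE; apply/esym/setIidPl.
Qed.

Lemma meagerU A B : meager A -> meager B -> meager (A `|` B).
Proof.
move=> [F F0 ->] [G G0 ->].
exists (fun n => if odd n then G n./2 else F n./2).
  by move=> n; case: ifP.
apply/seteqP; split=> [x [[n _ Fx]|[n _ Gx]]|x [n _]].
- by exists n.*2 => //; rewrite odd_double doubleK.
- by exists n.*2.+1 => //=; rewrite odd_double /= uphalf_double.
- by case: ifP => _ ?; [right|left]; exists n./2.
Qed.

Lemma meager_ideal : ideal (@meager X).
Proof.
by split; [exists set0; exact: meager0|exact: meagerS|exact: meagerU].
Qed.

Lemma meager_invariant : topologically_invariant (@meager X).
Proof.
have im h A : homeomorphism h -> meager A -> meager (h @` A).
  move=> hh [F F0 ->]; exists (fun n => h @` F n); last exact: image_bigcup.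
  by move=> n; exact: nowhere_dense_homeomorphism.
move=> h hh; apply/seteqP; split=> [A mA|_ [A mA <-]]; last exact: im.
have [ch [g [cg hK gK]]] := hh.
exists (g @` A); first by apply: im => //; split=> //; exists h.
by rewrite image_comp (eq_imagel (f' := id)) ?image_id // => x _; exact: gK.
Qed.

Lemma meager_BP_base : has_BP_base (@meager X).
Proof.
exists meager; first by split=> // A mA; exists A.
by move=> A mA; exists set0; [exact: open0|rewrite setY0].
Qed.

(** Baire category by nested open sets: by regularity each one contains the closure of the next,
    which also avoids the next nowhere dense set. Compactness gives a point common to all the
    closures. *)
Lemma compact_hausdorff_not_meager :
  hausdorff_space X -> compact [set: X] -> [set: X] !=set0 ->
  ~ meager [set: X].
Proof.
move=> hX cX [x0 _] [F F0 XF].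
(* The conditions on [nU.2] stand below the existential so that [choice] yields a total function;
   [set0] is the default value when they fail. *)
have step (nU : nat * set X) : exists V : set X,
    open nU.2 -> nU.2 !=set0 ->
    [/\ open V, V !=set0, closure V `<=` nU.2 & closure V `<=` ~` F nU.1].
  case: nU => n U /=.
  have [[oU U0]|/not_andP nU] := pselect (open U /\ U !=set0); last first.
    by exists set0 => oU U0; case: nU.
  have [x [Ux Fx]] : (U `\` closure (F n)) !=set0.
    apply/set0P/negP => /eqP; rewrite setD_eq0 => UF.
    case: U0 => u Uu; suff : (closure (F n))° u by rewrite F0.
    by move: oU; rewrite openE => /(_ _ Uu); exact: filterS.
  have Wx : nbhs x (U `\` closure (F n)).
    apply: open_nbhs_nbhs; split; last by [].
    by apply: openI => //; exact/closed_openC/closed_closure.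
  have [V Vx VW] := compact_regular hX cX (filterT : nbhs x _) Wx.
  exists V° => _ _.
  have clV : closure V° `<=` U `\` closure (F n).
    exact: (subset_trans (closureS (@interior_subset _ V)) VW).
  split; [exact: open_interior|by exists x| |] => y /clV [] //.
  by move=> _ nFy Fy; apply: nFy; exact: subset_closure.
have [f Pf] := choice step.
pose U := fix U n := if n is m.+1 then f (m, U m) else [set: X].
have U0 n : open (U n) /\ U n !=set0.
  elim: n => [|n [oU U0]] /=; first by split; [exact: openT|exists x0].
  by have [] := Pf (n, U n) oU U0.
have US n : closure (U n.+1) `<=` U n /\ closure (U n.+1) `<=` ~` F n.
  by have [oU ?] := U0 n; have [] := Pf (n, U n) oU.
have Umono m n : (m <= n)%N -> U n `<=` U m.
  elim: n => [|n IH]; first by rewrite leqn0 => /eqP ->.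
  rewrite leq_eqVlt => /predU1P[-> //|/IH]; apply: subset_trans.
  by apply: subset_trans (US n).1; exact: subset_closure.
have [a Ua] := choice (fun n => (U0 n).2).
(* The sequence [a] stays in [U n] from rank [n] on, so its cluster points lie in every
   [closure (U n)]. *)
have [l [_ al]] : [set: X] `&` cluster (a @ \oo) !=set0.
  by apply: cX; exact: filterT.
have clU n : closure (U n) l.
  move=> B Bl; have [|y [Uy By]] := al (U n) B _ Bl; last by exists y.
  by exists n => // m /= nm; exact: Umono (Ua m).
have [n _ Fl] : (\bigcup_n F n) l by rewrite -XF.
exact: (US n).2 (clU n.+1) Fl.
Qed.

End Topology.

(** * Ideals on compact spaces *)

Lemma compact_sigma_compact_base (X : topologicalType) :
  compact [set: X] -> has_sigma_compact_base (@meager X).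
Proof.
move=> cX; exists [set A | meager A /\ sigma_compact A]; last by move=> A [].
split=> [A []//|A [F F0 ->]].
(* Closing the pieces keeps them nowhere dense and, in a compact space, makes them compact. *)
exists (\bigcup_n closure (F n)).
  split; exists (fun n => closure (F n)) => // n.
    rewrite /nowhere_dense; have /closure_id <- := @closed_closure _ (F n).
    exact: F0.
  by apply: subclosed_compact cX _ => //; exact: closed_closure.
by apply: subset_bigcup => n _; exact: subset_closure.
Qed.

Definition minimal_action (X : topologicalType) := forall (x : X) (U : set X),
  open U -> U !=set0 -> exists2 h, homeomorphism h & U (h x).

(** The covering argument is run through the dual filter: if [I] misses the whole space, the
    complements of its members form a proper filter, which clusters at some [x]. A homeomorphic copy
    of [U] is then a neighbourhood of [x] in [I], and it must meet its own complement. *)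
Lemma invariant_ideal_open (X : topologicalType) (I : set (set X)) (U : set X) :
  compact [set: X] -> minimal_action X ->
  ideal I -> topologically_invariant I -> open U -> U !=set0 -> I U ->
  I = setT.
Proof.
move=> cX mX [I0 IS IU] Iinv oU U0 UI.
have [IT|nIT] := pselect (I setT).
  by apply/seteqP; split=> // A _; apply: IS IT.
pose F : set_system X := [set A | I (~` A)].
have FF : ProperFilter F.
  split; first by rewrite /F /= setC0.
  split.
  - by rewrite /F /= setCT; case: I0 => A; exact: IS.
  - by move=> A B IA IB; rewrite /F /= setCI; exact: IU.
  - by move=> A B AB; apply: IS; exact: subsetC.
have [x [_ Fx]] : [set: X] `&` cluster F !=set0.
  by apply: cX; exact: filterT.
have [h hh Uhx] := mX x U oU U0.
have [ch [g [cg hK gK]]] := hh.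
have hUI : I (h @^-1` U).
  have hg : homeomorphism g by split=> //; exists h.
  (* The preimage of [U] under [h] is its image under the inverse [g], to which invariance
     applies. *)
  rewrite (Iinv g hg); exists U => //.
  apply/seteqP; split=> [_ [u Uu <-] /=|y Uhy]; first by rewrite gK.
  by exists (h y).
have [y []] : ~` (h @^-1` U) `&` (h @^-1` U) !=set0.
  apply: Fx; first by rewrite /F /= setCK.
  by apply: ch; apply: open_nbhs_nbhs.
by [].
Qed.

(** * Convergence and continuity in initial and product topologies *)

Lemma cvg_initial_topology (Y : choiceType) (Z : topologicalType) (w : Y -> Z)
    (F : set_system Y) (z : Y) {FF : Filter F} :
  w @ F --> w z -> F --> (z : initial_topology w).
Proof.
move=> cw U [_ [[W oW <-] Wz]] /filterS; apply; apply: cw.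
exact: open_nbhs_nbhs.
Qed.

Lemma cvg_prod_topology (K : nat -> topologicalType)
    (F : set_system (prod_topology K)) (x : prod_topology K) {FF : Filter F} :
  (forall k, proj k @ F --> x k) -> F --> x.
Proof.
by move=> Fx; apply/cvg_sup => k; exact: cvg_initial_topology (Fx k).
Qed.

Lemma prod_topology_continuous (Y : topologicalType)
    (K : nat -> topologicalType) (f : Y -> prod_topology K) :
  (forall k, continuous (fun y => f y k)) -> continuous f.
Proof. by move=> cf y; apply: cvg_prod_topology => k; exact: cf. Qed.

(** * Homeomorphisms of a power acting on two consecutive coordinates *)

Section AdjacentCoordinates.
Context {T : topologicalType}.
Implicit Types (phi : T * T -> T * T) (x : prod_topology (fun _ : nat => T)).

Definition on_adjacent n phi x : prod_topology (fun _ : nat => T) :=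
  fun k => if k == n then (phi (x n, x n.+1)).1
           else if k == n.+1 then (phi (x n, x n.+1)).2 else x k.

Lemma on_adjacent_continuous n phi :
  continuous phi -> continuous (on_adjacent n phi).
Proof.
move=> cphi; apply: (@prod_topology_continuous _ (fun=> T)) => k x.
have cn j : (fun y : prod_topology (fun _ : nat => T) => y j) @ x --> x j.
  exact: proj_continuous.
have cpair : (fun y : prod_topology (fun _ : nat => T) => phi (y n, y n.+1)) @ x
    --> phi (x n, x n.+1).
  apply: (cvg_comp _ _ (cvg_pair (cn n) (cn n.+1))); exact: cphi.
rewrite /on_adjacent; case: eqP => [_|_].
  by apply: (cvg_comp _ fst cpair); exact: cvg_fst.
case: eqP => [_|_]; last exact: cn.
by apply: (cvg_comp _ snd cpair); exact: cvg_snd.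
Qed.

Lemma on_adjacentK n phi psi :
  cancel phi psi -> cancel (on_adjacent n phi) (on_adjacent n psi).
Proof.
move=> phiK x; apply/funext => k; rewrite /on_adjacent !eqxx.
rewrite (gtn_eqF (ltnSn n)) -surjective_pairing phiK /=.
by case: eqP => [->//|_]; case: eqP => [->|].
Qed.

Lemma on_adjacent_homeomorphism n phi :
  homeomorphism phi -> homeomorphism (on_adjacent n phi).
Proof.
move=> [cphi [psi [cpsi phiK psiK]]]; split; first exact: on_adjacent_continuous.
exists (on_adjacent n psi).
by split; [exact: on_adjacent_continuous|exact: on_adjacentK..].
Qed.

End AdjacentCoordinates.

Lemma pair_continuous (S U V : topologicalType) (f : S -> U) (g : S -> V) :
  continuous f -> continuous g -> continuous (fun s => (f s, g s)).
Proof. by move=> cf cg s; apply: cvg_pair; [exact: cf|exact: cg]. Qed.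

Lemma swap_homeomorphism (T : topologicalType) :
  homeomorphism (fun p : T * T => (p.2, p.1)).
Proof.
have c : continuous (fun p : T * T => (p.2, p.1)).
  by apply: pair_continuous => x; [exact: cvg_snd|exact: cvg_fst].
by split=> //; exists (fun p => (p.2, p.1)); split=> // -[].
Qed.

Lemma fst_homeomorphism (T : topologicalType) (m : T -> T) :
  homeomorphism m -> homeomorphism (fun p : T * T => (m p.1, p.2)).
Proof.
have c (f : T -> T) :
    continuous f -> continuous (fun p : T * T => (f p.1, p.2)).
  move=> cf; apply: pair_continuous => p; last exact: cvg_snd.
  by apply: (cvg_comp _ f cvg_fst); exact: cf.
move=> [cm [g [cg mK gK]]]; split; first exact: c.
exists (fun p => (g p.1, p.2)); split; first exact: c.
  by move=> [a b] /=; rewrite mK.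
by move=> [a b] /=; rewrite gK.
Qed.

(** * The unit interval, and homeomorphisms moving its interior points *)

Section UnitInterval.
Context {R : realType}.
Local Notation I := (set_type (`[0%R, 1%R]%classic : set R)).
Implicit Types (t : R) (a b : I).

Lemma clamp_subproof t :
  Num.max 0 (Num.min 1 t) \in (`[0%R, 1%R]%classic : set R).
Proof.
by rewrite inE /= in_itv /= le_max lexx /= ge_max ler01 ge_min lexx.
Qed.

(** A continuous retraction of the line onto the interval: maps into the subtype can be given by
    real formulas, with values outside the interval harmlessly truncated. *)
Definition clamp t : I := SigSub (clamp_subproof t).

Lemma clampK t : 0 <= t <= 1 -> val (clamp t) = t.
Proof. by move=> /andP[t0 t1] /=; rewrite min_r // max_r. Qed.

Lemma val01 a : 0 <= val a <= 1.
Proof. by case: a => t /=; rewrite inE /= in_itv. Qed.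

Lemma val_clampK a : clamp (val a) = a.
Proof. by apply: val_inj; rewrite clampK // val01. Qed.

Lemma clamp_continuous : continuous clamp.
Proof.
apply: continuous_comp_initial => t /=.
apply: (@continuous_max R R); first exact: cvg_cst.
by apply: (@continuous_min R R); [exact: cvg_cst|exact: cvg_id].
Qed.

Lemma val_continuous : continuous (val : I -> R).
Proof. exact: initial_continuous. Qed.

Lemma unit_interval_compact : compact [set: I].
Proof.
have -> : [set: I] = clamp @` `[0, 1].
  apply/seteqP; split=> // a _; exists (val a); last exact: val_clampK.
  by rewrite /= in_itv val01.
apply: continuous_compact; last exact: segment_compact.
exact/continuous_subspaceT/clamp_continuous.
Qed.

Lemma unit_interval_hausdorff : hausdorff_space I.
Proof.
move=> a b ab; apply: val_inj; apply: (@Rhausdorff R) => A B Aa Bb.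
have [c [Ac Bc]] := ab _ _ (val_continuous Aa) (val_continuous Bb).
by exists (val c).
Qed.

(** In the coordinate [t / (1 - t)] this is multiplication by [c], whence the inverse with parameter
    [c^-1]. *)
Definition moebius (c t : R) : R := c * t / (1 + (c - 1) * t).

Lemma moebius_denom_gt0 c t : 0 < c -> 0 <= t <= 1 -> 0 < 1 + (c - 1) * t.
Proof. by move=> c0 /andP[t0 t1]; nra. Qed.

Lemma moebius01 c t : 0 < c -> 0 <= t <= 1 -> 0 <= moebius c t <= 1.
Proof.
move=> c0 t01; have d0 := moebius_denom_gt0 c0 t01.
move: t01 => /andP[t0 t1]; rewrite /moebius ler_pdivrMr // ler_pdivlMr //.
by apply/andP; split; nra.
Qed.

Lemma moebiusK c t : 0 < c -> 0 <= t <= 1 -> moebius c^-1 (moebius c t) = t.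
Proof.
move=> c0 t01; have d0 := moebius_denom_gt0 c0 t01.
rewrite /moebius; field.
rewrite gt_eqF //= gt_eqF //=.
by lra.
Qed.

Lemma moebius_continuous c t :
  0 < c -> 0 <= t <= 1 -> {for t, continuous (moebius c)}.
Proof.
move=> c0 t01; have cm u : (fun s : R => u * s) @ t --> u * t.
  by apply: cvgM; [exact: cvg_cst|exact: cvg_id].
apply: (cvgM (cm c)); apply: cvgV; first by rewrite gt_eqF // moebius_denom_gt0.
by apply: cvgD; [exact: cvg_cst|exact: cm].
Qed.

Lemma moebius_homeomorphism c :
  0 < c -> homeomorphism (fun a => clamp (moebius c (val a))).
Proof.
have cont d : 0 < d -> continuous (fun a => clamp (moebius d (val a))).
  move=> d0 a; apply: (@continuous_comp I R I (moebius d \o val) clamp);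
    last exact: clamp_continuous.
  apply: (@continuous_comp I R R val (moebius d)); first exact: val_continuous.
  by apply: moebius_continuous => //; exact: val01.
have K d : 0 < d -> cancel (fun a => clamp (moebius d (val a)))
                           (fun a => clamp (moebius d^-1 (val a))).
  move=> d0 a; rewrite clampK ?moebius01 ?val01 //.
  by rewrite moebiusK ?val01 // val_clampK.
move=> c0; split; first exact: cont.
exists (fun a => clamp (moebius c^-1 (val a))); split.
- by apply: cont; rewrite invr_gt0.
- exact: K.
- by have := K c^-1; rewrite invrK invr_gt0; exact.
Qed.

Lemma interval_interior_transitive a t : 0 < val a < 1 -> 0 < t < 1 ->
  exists2 m : I -> I, homeomorphism m & val (m a) = t.
Proof.
move=> /andP[a0 a1] /andP[t0 t1].
(* The quotient of [t / (1 - t)] by [val a / (1 - val a)]. *)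
pose c := t * (1 - val a) / (val a * (1 - t)).
have c0 : 0 < c by rewrite divr_gt0 // mulr_gt0 // subr_gt0.
exists (fun a => clamp (moebius c (val a))); first exact: moebius_homeomorphism.
rewrite clampK ?moebius01 ?val01 //.
have cE : c * (val a * (1 - t)) = t * (1 - val a).
  by rewrite /c divfK // mulf_neq0 // gt_eqF // subr_gt0.
have d0 := moebius_denom_gt0 c0 (val01 a).
apply: (mulIf (lt0r_neq0 d0)); rewrite /moebius divfK ?gt_eqF //; nra.
Qed.

(** * Rotation of the square *)

Definition cut (r z : R) : R := Num.max (- r) (Num.min r z).

Lemma cut_low r z : 0 <= r -> z <= - r -> cut r z = - r.
Proof. by move=> r0 zr; rewrite /cut min_r ?max_l //; lra. Qed.

Lemma cut_id r z : - r <= z <= r -> cut r z = z.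
Proof. by move=> /andP[z1 z2]; rewrite /cut min_r ?max_r. Qed.

Lemma cut_high r z : 0 <= r -> r <= z -> cut r z = r.
Proof. by move=> r0 zr; rewrite /cut min_l ?max_r //; lra. Qed.

(** The boundary of the square of radius [r], as linear constraints and a choice of side, which
    suits case analysis with [lra]. *)
Definition sup_norm_eq (r x y : R) : Prop :=
  [/\ - r <= x <= r, - r <= y <= r & [\/ x = r, x = - r, y = r | y = - r]].

Lemma sup_norm_eqP r x y : sup_norm_eq r x y <-> Num.max `|x| `|y| = r.
Proof.
split=> [[/andP[x1 x2] /andP[y1 y2] xyr]|<-].
  case: (ger0P x) => x0; case: (ger0P y) => y0;
  case: leP => xy; case: xyr => ?; lra.
rewrite /sup_norm_eq -!ler_norml !le_max !lexx orbT; split=> //.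
case: (leP `|x| `|y|) => _.
  by case: (ger0P y) => _; [constructor 3|constructor 4; lra].
by case: (ger0P x) => _; [constructor 1|constructor 2; lra].
Qed.

(* On the sphere of radius [r] of the sup norm, the rotation by an eighth of a
   turn followed by a reflection is this clamped linear map. The reflection
   makes it an involution; corners go to midpoints of sides. *)
Lemma sup_norm_eq_cut r x y (p := cut r (x + y)) (q := cut r (x - y)) :
  sup_norm_eq r x y ->
  [/\ sup_norm_eq r p q, cut r (p + q) = x & cut r (p - q) = y].
Proof.
move=> [/andP[x1 x2] /andP[y1 y2] xyr].
have r0 : 0 <= r by lra.
have cutE u z : - r <= u <= r ->
    [\/ z = u, u = r /\ r <= z | u = - r /\ z <= - r] -> cut r z = u.
  move=> ur [->|[-> rz]|[-> zr]].
  - exact: cut_id.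
  - exact: cut_high.
  - exact: cut_low.
(* It suffices to guess [p] and [q] as linear expressions; the four values of [cut] then become
   choices among linear conditions. *)
have {cutE} H p' q' : sup_norm_eq r p' q' ->
    [\/ x + y = p', p' = r /\ r <= x + y | p' = - r /\ x + y <= - r] ->
    [\/ x - y = q', q' = r /\ r <= x - y | q' = - r /\ x - y <= - r] ->
    [\/ p' + q' = x, x = r /\ r <= p' + q' | x = - r /\ p' + q' <= - r] ->
    [\/ p' - q' = y, y = r /\ r <= p' - q' | y = - r /\ p' - q' <= - r] ->
    [/\ sup_norm_eq r p q, cut r (p + q) = x & cut r (p - q) = y].
  move=> pq p1 q1 x3 y3; have [p2 q2 _] := pq.
  have -> : p = p' by exact: cutE.
  have -> : q = q' by exact: cutE.
  by split=> //; apply: cutE => //; exact/andP.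
rewrite /sup_norm_eq in H.
(* Each side is split at its midpoint: on a half-side one of [p], [q] is constant, equal to [r] or
   [- r], and the other is linear. *)
case: xyr => E; subst.
- by case: (leP 0 y) => y0; [apply: (H r (r - y))|apply: (H (r + y) r)];
    first [constructor 1; lra|constructor 2; lra|constructor 3; lra|
           split; [lra|lra|first [constructor 1; lra|constructor 3; lra]]].
- by case: (leP 0 y) => y0;
    [apply: (H (- r + y) (- r))|apply: (H (- r) (- r - y))];
    first [constructor 1; lra|constructor 2; lra|constructor 3; lra|
           split; [lra|lra|first [constructor 2; lra|constructor 4; lra]]].
- by case: (leP 0 x) => x0; [apply: (H r (x - r))|apply: (H (x + r) (- r))];
    first [constructor 1; lra|constructor 2; lra|constructor 3; lra|
           split; [lra|lra|first [constructor 1; lra|constructor 4; lra]]].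
- by case: (leP 0 x) => x0; [apply: (H (x - r) r)|apply: (H (- r) (x + r))];
    first [constructor 1; lra|constructor 2; lra|constructor 3; lra|
           split; [lra|lra|first [constructor 2; lra|constructor 3; lra]]].
Qed.

Lemma clamp_cut_continuous (T : topologicalType) (x y z : T -> R) :
  continuous x -> continuous y -> continuous z ->
  continuous (fun p => clamp (2^-1 + cut (Num.max `|x p| `|y p|) (z p))).
Proof.
move=> cx cy cz p.
have cr : {for p, continuous (fun p => Num.max `|x p| `|y p| : R^o)}.
  apply: (@continuous_max R T (fun p => `|x p|) (fun p => `|y p|)).
    by apply: cvg_norm; exact: cx.
  by apply: cvg_norm; exact: cy.
apply: (@continuous_comp T R I _ clamp); last exact: clamp_continuous.
apply: cvgD; first exact: cvg_cst.
apply: (@continuous_max R T (fun p => - Num.max `|x p| `|y p|)).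
  by apply: cvgN; exact: cr.
by apply: (@continuous_min R T); [exact: cr|exact: cz].
Qed.

(** With the origin moved to the centre of the square, every concentric square boundary is mapped to
    itself by the clamped linear map above. *)
Definition rotate (s : I * I) : I * I :=
  let x := val s.1 - 2^-1 in let y := val s.2 - 2^-1 in
  let r := Num.max `|x| `|y| in
  (clamp (2^-1 + cut r (x + y)), clamp (2^-1 + cut r (x - y))).

Lemma rotate_center (s : I * I) (x := val s.1 - 2^-1) (y := val s.2 - 2^-1)
    (r := Num.max `|x| `|y|) :
  val (rotate s).1 - 2^-1 = cut r (x + y) /\
  val (rotate s).2 - 2^-1 = cut r (x - y).
Proof.
have [p1 p2 _] := (sup_norm_eqP r x y).2 erefl.
have [[q1 q2 _] _ _] := sup_norm_eq_cut ((sup_norm_eqP r x y).2 erefl).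
(* The radius never exceeds half the side, so the outer [clamp] in [rotate] does not truncate. *)
have r1 : r <= 2^-1.
  rewrite /r ge_max !ler_norml.
  have /andP[? ?] := val01 s.1; have /andP[? ?] := val01 s.2.
  by apply/andP; split; apply/andP; split; rewrite /x /y; lra.
rewrite !clampK; [|lra..].
by rewrite -/x -/y -/r; split; lra.
Qed.

(** The sup norm about the centre is preserved, so the second application uses the same radius and
    [sup_norm_eq_cut] gives the original coordinates back. *)
Lemma rotateK : involutive rotate.
Proof.
move=> s; have [e1 e2] := rotate_center s.
have [e3 e4] := rotate_center (rotate s); move: e3 e4; rewrite e1 e2.
set x := val s.1 - _; set y := val s.2 - _; set r := Num.max `|x| `|y|.
have [+ + +] := sup_norm_eq_cut ((sup_norm_eqP r x y).2 erefl).
move=> /sup_norm_eqP -> -> -> /addIr/val_inj e3 /addIr/val_inj e4.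
by rewrite (surjective_pairing (rotate _)) e3 e4 -surjective_pairing.
Qed.

Lemma rotate_homeomorphism : homeomorphism rotate.
Proof.
suff c : continuous rotate.
  by split=> //; exists rotate; split=> //; exact: rotateK.
have cB : continuous (fun a => val a - 2^-1).
  move=> a; apply: (@continuous_comp I R R val (fun t => t - 2^-1)).
    exact: val_continuous.
  by apply: cvgB; [exact: cvg_id|exact: cvg_cst].
have cx : continuous (fun s : I * I => val s.1 - 2^-1).
  move=> s; apply: (@continuous_comp _ I R fst (fun a => val a - 2^-1)).
    exact: cvg_fst.
  exact: cB.
have cy : continuous (fun s : I * I => val s.2 - 2^-1).
  move=> s; apply: (@continuous_comp _ I R snd (fun a => val a - 2^-1)).
    exact: cvg_snd.
  exact: cB.
have cD (T : topologicalType) (f g : T -> R) :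
    continuous f -> continuous g -> continuous (fun p => f p + g p).
  by move=> cf cg p; apply: cvgD; [exact: cf|exact: cg].
have cN (T : topologicalType) (f : T -> R) :
    continuous f -> continuous (fun p => - f p).
  by move=> cf p; apply: cvgN; exact: cf.
apply: pair_continuous.
  by apply: clamp_cut_continuous => //; exact: cD.
by apply: clamp_cut_continuous => //; apply: cD => //; exact: cN.
Qed.

(** If neither coordinate is interior, [s] is a corner. On the diagonal the centred difference
    vanishes, so the second coordinate of [rotate s] is one half and a swap brings it first; on the
    antidiagonal the centred sum vanishes and the first coordinate is already one half. *)
Lemma square_corner_to_interior (s : I * I) :
  exists2 phi : I * I -> I * I, homeomorphism phi & 0 < val (phi s).1 < 1.
Proof.
have [s1|s1] := boolP (0 < val s.1 < 1).
  by exists id; [exact: homeomorphism_id|].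
have [s2|s2] := boolP (0 < val s.2 < 1).
  by exists (fun p => (p.2, p.1)); [exact: swap_homeomorphism|].
have end01 a : ~~ (0 < val a < 1) -> val a = 0 \/ val a = 1.
  have /andP[a0 a1] := val01 a; rewrite negb_and -!leNgt.
  by case/orP => ?; [left|right]; lra.
have [e1 e2] := rotate_center s.
have [e|e] := eqVneq (val s.1) (val s.2).
  exists (fun p => ((rotate p).2, (rotate p).1)).
    exact: (homeomorphism_comp (@swap_homeomorphism _) rotate_homeomorphism).
  move: e2; rewrite /= e subrr cut_id; last first.
    by rewrite oppr_le0 andbb le_max normr_ge0.
  by lra.
have sum0 : val s.1 - 2^-1 + (val s.2 - 2^-1) = 0.
  by case: (end01 _ s1) (end01 _ s2) e => -> [] ->; rewrite ?eqxx // => _; lra.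
exists rotate; first exact: rotate_homeomorphism.
move: e1; rewrite sum0 cut_id; last by rewrite oppr_le0 andbb le_max normr_ge0.
by lra.
Qed.

(** The second coordinate of the image is left uncontrolled: in the cube it is adjusted at the next
    step. *)
Lemma square_transitive (s : I * I) (t : R) : 0 < t < 1 ->
  exists2 phi : I * I -> I * I, homeomorphism phi & val (phi s).1 = t.
Proof.
move=> t01; have [phi hphi phis] := square_corner_to_interior s.
have [m hm mt] := interval_interior_transitive phis t01.
exists ((fun p => (m p.1, p.2)) \o phi) => //.
by apply: homeomorphism_comp => //; exact: fst_homeomorphism.
Qed.

End UnitInterval.

(** * Density of the orbits in the Hilbert cube *)

Section HilbertCube.
Context {R : realType}.
Local Notation I := (set_type (`[0%R, 1%R]%classic : set R)).
Implicit Types (x u : hilbert_cube R).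

Lemma hilbert_cube_compact : compact [set: hilbert_cube R].
Proof.
have := @tychonoff nat (fun=> I) (fun=> setT) (fun=> unit_interval_compact).
by congr compact; apply/seteqP.
Qed.

Lemma hilbert_cube_hausdorff : hausdorff_space (hilbert_cube R).
Proof.
exact: (@hausdorff_product nat (fun=> I) (fun=> @unit_interval_hausdorff R)).
Qed.

Lemma hilbert_cube_move x u (e : R) n : 0 < e ->
  exists2 h : hilbert_cube R -> hilbert_cube R, homeomorphism h &
    forall i, (i < n)%N -> `|val (h x i) - val (u i)| < e.
Proof.
move=> e0; elim: n => [|n [h hh hx]].
  by exists id; [exact: homeomorphism_id|].
(* The target is [val (u n)] pushed towards one half by the fraction [d]: strictly inside the
   interval even when [u n] is an endpoint, and at distance at most [d / 2] from it. *)
pose d := Num.min e 1; pose t := (1 - d) * val (u n) + d * 2^-1.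
have [d0 d1 de] : [/\ 0 < d, d <= 1 & d <= e].
  by rewrite /d lt_min e0 ltr01 !ge_min !lexx orbT.
have /andP[u0 u1] := val01 (u n).
have t01 : 0 < t < 1 by apply/andP; split; rewrite /t; nra.
have tu : `|t - val (u n)| < e.
  by rewrite /t ltr_norml; apply/andP; split; nra.
have [phi hphi phit] := square_transitive (h x n, h x n.+1) t01.
exists (on_adjacent n phi \o h).
  by apply: homeomorphism_comp => //; exact: on_adjacent_homeomorphism.
move=> i; rewrite ltnS leq_eqVlt => /predU1P[->|lt_in].
  by rewrite /= /on_adjacent eqxx phit.
by rewrite /= /on_adjacent (ltn_eqF lt_in) (ltn_eqF (leqW lt_in)) hx.
Qed.

(** Controlling [n] coordinates up to [n.+1%:R^-1] gives images of [x] that converge to [u]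
    coordinatewise, hence in the product, so they eventually enter [U]. *)
Lemma hilbert_cube_minimal : minimal_action (hilbert_cube R).
Proof.
move=> x U oU [u Uu].
have /choice[h hP] n : exists h : hilbert_cube R -> hilbert_cube R,
    homeomorphism h /\
    forall i, (i < n)%N -> `|val (h x i) - val (u i)| < n.+1%:R^-1.
  by have [|h] := @hilbert_cube_move x u n.+1%:R^-1 n; [|exists h].
have hxu : (fun n => h n x) @ \oo --> u.
  apply: (@cvg_prod_topology (fun=> I)) => k.
  apply: cvg_initial_topology.
  have : (fun n => val (h n x k)) @ \oo --> val (u k); last by [].
  apply/cvgrPdist_lt => e e0; near=> n.
  rewrite distrC; apply: lt_trans ((hP n).2 k _) _.
    by near: n; exact: nbhs_infty_gt.
  by near: n; exact: near_infty_natSinv_lt (PosNum e0).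
have [n _ /(_ n (leqnn n)) /= Uhn] : \forall n \near \oo, U (h n x).
  by apply: hxu; exact: open_nbhs_nbhs.
by exists (h n) => //; have [] := hP n.
Unshelve. all: by end_near. Qed.

(** * Nontriviality of the meager ideal, witnessed by a face of the cube *)

Definition face : set (hilbert_cube R) := [set x | x 0%N = clamp 0].

Lemma clamp01 : clamp 0 <> clamp 1 :> I.
Proof.
move=> /(congr1 val); rewrite !clampK ?lexx ?ler01 // => /eqP.
by rewrite eq_sym oner_eq0.
Qed.

(** The face is closed, and projections are open: an interior point would make the singleton of
    [clamp 0] a neighbourhood in the interval, yet [clamp t] is close to it for small positive
    [t]. *)
Lemma face_nowhere_dense : nowhere_dense face.
Proof.
have /closure_id cl : closed face.
  have -> : face = @proj nat (fun=> I) 0%N @^-1` [set clamp 0] by [].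
  apply: closed_comp; first by move=> x _; exact: proj_continuous.
  exact/accessible_closed_set1/hausdorff_accessible/unit_interval_hausdorff.
rewrite /nowhere_dense -cl -subset0 => x fx.
have x0 : x 0%N = clamp 0 by have := interior_subset fx.
have : nbhs (clamp 0) (@proj nat (fun=> I) 0%N @` face°).
  apply: open_nbhs_nbhs; split.
    exact: (@proj_open nat (fun=> I) 0%N _ (@open_interior _ _)).
  by exists x.
move=> /(@clamp_continuous R) /nbhs_ballP[e /= e0 be].
pose t := Num.min (e / 2) 1.
have t0 : 0 < t by rewrite lt_min divr_gt0 // ltr01.
have te : t < e by rewrite gt_min ltr_pdivrMr // ltr_pMr // ltr1n.
have [|y /interior_subset fy yt] := be t.
  by rewrite /ball /= sub0r normrN gtr0_norm.
have : clamp t = clamp 0 :> I by rewrite -yt -fy.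
move=> /(congr1 val); rewrite !clampK ?lexx ?ler01 //.
  by move=> tE; rewrite tE ltxx in t0.
by rewrite ltW //= ge_min lexx orbT.
Qed.

(* Cantor's diagonal argument on the coordinates of positive index. *)
Lemma face_uncountable : ~ countable face.
Proof.
move=> /countable_injP[f finj].
have /choice[v vP] n : exists v : I, forall a, face a -> f a = n -> a n.+1 <> v.
  have [[a [fa an]]|na] := pselect (exists a, face a /\ f a = n).
    exists (if a n.+1 == clamp 0 then clamp 1 else clamp 0) => b fb bn.
    have -> : b = a by apply: finj; rewrite ?inE // an.
    by case: eqP => // ->; exact: clamp01.
  by exists (clamp 0) => a fa an; case: na; exists a.
pose x : hilbert_cube R := fun k => if k is n.+1 then v n else clamp 0.
have fx : face x by [].
exact: vP _ _ fx erefl erefl.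
Qed.

Lemma hilbert_cube_meager_nontrivial :
  nontrivial_invariant_ideal (@meager (hilbert_cube R)).
Proof.
split; [exact: meager_ideal| |exact: meager_invariant].
split.
  exists face; last exact: face_uncountable.
  exact/nowhere_dense_meager/face_nowhere_dense.
move=> mT; have : meager [set: hilbert_cube R] by rewrite mT.
apply: compact_hausdorff_not_meager.
- exact: hilbert_cube_hausdorff.
- exact: hilbert_cube_compact.
- by exists (fun=> clamp 0).
Qed.

End HilbertCube.

Theorem theorem1p1 (R : realType) :
  let M : set (set (hilbert_cube R)) := meager in
  [/\ nontrivial_invariant_ideal M,
      has_BP_base M &
      forall I : set (set (hilbert_cube R)),
        nontrivial_invariant_ideal I -> has_BP_base I ->
        M `<=` I -> I = M]
  /\
  [/\ nontrivial_invariant_ideal M,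
      has_sigma_compact_base M &
      forall I : set (set (hilbert_cube R)),
        nontrivial_invariant_ideal I -> has_sigma_compact_base I ->
        I `<=` M].
Proof.
move=> M.
have no_open (I : set (set (hilbert_cube R))) U : nontrivial_invariant_ideal I ->
    open U -> I U -> U = set0.
  move=> [iI [_ nIT] Iinv] oU IU; apply/eqP/negPn/negP => /set0P U0; apply: nIT.
  apply: invariant_ideal_open iI Iinv oU U0 IU.
    exact: hilbert_cube_compact.
  exact: hilbert_cube_minimal.
split; split.
- exact: hilbert_cube_meager_nontrivial.
- exact: meager_BP_base.
- move=> I ntI [B [BI IB] BP] MI; apply/seteqP; split=> // A IA.
  have [C BC AC] := IB _ IA; have [U oU mCU] := BP _ BC.
  have [_ IS IU] : ideal I by case: ntI.
  have U0 : U = set0.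
    apply: no_open ntI oU _.
    (* Here [M] inside [I] is used: the meager difference of [C] and [U] lies in [I], hence so does
       [U]. Once [U] is empty, that difference is [C] itself. *)
    apply: (IS _ (C `|` (C `+` U))); last by apply: IU; [exact: BI|exact: MI].
    by move=> x Ux; have [Cx|nCx] := pselect (C x); [left|right; right].
  by apply: meagerS AC _; move: mCU; rewrite U0 setY0.
- exact: hilbert_cube_meager_nontrivial.
- exact/compact_sigma_compact_base/hilbert_cube_compact.
- move=> I ntI [B [BI IB] BK] A IA.
  have [C BC AC] := IB _ IA; have [K cK CE] := BK _ BC.
  have [_ IS IU] : ideal I by case: ntI.
  (* Each compact [K n] is closed, so it is nowhere dense as soon as its interior, an open member of
     [I], is empty. *)
  apply: meagerS AC _; exists K => // n.
  apply: no_open ntI (@open_interior _ _) _.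
  have /closure_id <- : closed (K n).
    by apply: compact_closed (cK n); exact: hilbert_cube_hausdorff.
  apply: IS (BI _ BC); rewrite CE.
  by apply: subset_trans (@interior_subset _ _) _; exact: bigcup_sup.
Qed.
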